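(* Let $F_1,F_2$ be two distinct points in the Euclidean plane. Consider the three-bar linkage consisting of rods $F_1A$, $AB$, $F_2B$ with $F_1$ and $F_2$ fixed, with $|F_1A|=|F_2B|=\frac{1}{\sqrt2}|F_1F_2|$ and $|AB|=|F_1F_2|$, and with $A$ and $B$ lying on opposite sides of the line $F_1F_2$. Then, during the motion of the linkage, the midpoint $X$ of the rod $AB$ traces the lemniscate of Bernoulli with foci $F_1$ and $F_2$. That is, the set of midpoints of $AB$, taken over all pairs of points $(A,B)$ satisfying these length conditions and such that either $A$ and $B$ lie strictly on opposite sides of the line $F_1F_2$ or both $A$ and $B$ lie on the line $F_1F_2$ (the limiting positions of the motion), is exactly the lemniscate of Bernoulli with foci $F_1$ and $F_2$.
   Context: The lemniscate of Bernoulli with foci $F_1\neq F_2$ is the set of points $X$ of the plane such that $|F_1X|\cdot|F_2X|=\frac14|F_1F_2|^2$. *)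

(* Defs.v *)
From Stdlib Require Import Reals.
Open Scope R_scope.

Definition point : Type := R * R.

Definition pdist (P Q : point) : R := dist_euc (fst P) (snd P) (fst Q) (snd Q).

Definition affine_comb (t : R) (P Q : point) : point :=
  ((1 - t) * fst P + t * fst Q, (1 - t) * snd P + t * snd Q).

Definition midpoint (P Q : point) : point := affine_comb (1 / 2) P Q.

(* This is the line through P and Q only when P <> Q. *)
Definition on_line (P Q Z : point) : Prop :=
  exists t : R, Z = affine_comb t P Q.

Definition on_segment (P Q Z : point) : Prop :=
  exists t : R, 0 <= t <= 1 /\ Z = affine_comb t P Q.

(* Strict separation by the line PQ: neither point is on the line, and the
   segment joining them meets it. *)
Definition opposite_sides (P Q A B : point) : Prop :=
  ~ on_line P Q A /\ ~ on_line P Q B /\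
  exists Z : point, on_line P Q Z /\ on_segment A B Z.

Definition lemniscate (F1 F2 X : point) : Prop :=
  pdist F1 X * pdist F2 X = 1 / 4 * pdist F1 F2 ^ 2.

Definition linkage_lengths (F1 F2 A B : point) : Prop :=
  pdist F1 A = 1 / sqrt 2 * pdist F1 F2 /\
  pdist F2 B = 1 / sqrt 2 * pdist F1 F2 /\
  pdist A B = pdist F1 F2.

(* The second alternative consists of the limiting positions of the motion. *)
Definition linkage_position (F1 F2 A B : point) : Prop :=
  linkage_lengths F1 F2 A B /\
  (opposite_sides F1 F2 A B \/ (on_line F1 F2 A /\ on_line F1 F2 B)).

(* Main.v *)
Require Import Defs.
From Stdlib Require Import Reals Lra.
Open Scope R_scope.

(** A similarity of the plane takes the foci to [(-1, 0)] and [(1, 0)].  In the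
    coordinates that it gives ([focal]) the rods have lengths [sqrt 2], [2],
    [sqrt 2], the condition on the sides only concerns the signs of the heights
    ([focal_linkage_position], [focal_lemniscate]), and the lemniscate has the
    equation [r * (2 - r) = 4 y^2], with [r = x^2 + y^2].

    Let [u = A - F1], [v = B - F2], and put [w = u - v].  The midpoint of [AB],
    seen from the centre of [F1F2], is [s = (u + v) / 2].  The equality
    [|u| = |v| = sqrt 2] says that [s] is orthogonal to [w] and that
    [|s|^2 + |w|^2 / 4 = 2], and [|AB| = 2] says that [|w|^2 = 4 w_x]; hence
    [r = |s|^2 = 2 - w_x].

    When [w <> 0], orthogonality gives [s = t (- w_y, w_x)] for some [t], so
    [w_x * r = 4 t^2 w_x^2 = 4 y^2], which is the equation of the lemniscate.
    When [w = 0], the figure [F1 A B F2] is a parallelogram; then [A] and [B]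
    are at the same height, so the condition on the sides puts both on the line
    of the foci, and [X] is a vertex of the lemniscate.  This is
    [unit_linkage_midpoint].

    Conversely, given a point [s <> 0] of the lemniscate, take
    [w = - (4 y / r) (- y, x)], the multiple of [(- y, x)] for which
    [|w|^2 = 4 w_x].  The product of the heights of the resulting [A] and [B] is
    [- 2 y^2 / r], so they are on opposite sides unless [y = 0], when both are
    on the line.  At the centre, [A = (0, 1)] and [B = (0, -1)] will do.  This is
    [unit_linkage_exists]. *)

Lemma sqr_pos (a : R) : a <> 0 -> 0 < a ^ 2.
Proof. rewrite <- Rsqr_pow2; apply Rsqr_pos_lt. Qed.

Lemma sum_sqr_nonneg (a b : R) : 0 <= a ^ 2 + b ^ 2.
Proof. apply Rplus_le_le_0_compat; apply pow2_ge_0. Qed.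

(** * The linkage with foci at distance two *)

Definition unit_linkage (xA yA xB yB : R) : Prop :=
  (xA + 1) ^ 2 + yA ^ 2 = 2 /\
  (xB - 1) ^ 2 + yB ^ 2 = 2 /\
  (xA - xB) ^ 2 + (yA - yB) ^ 2 = 4 /\
  (yA * yB < 0 \/ (yA = 0 /\ yB = 0)).

Definition unit_lemniscate (x y : R) : Prop :=
  ((x + 1) ^ 2 + y ^ 2) * ((x - 1) ^ 2 + y ^ 2) = 1.

Lemma unit_lemniscate_iff (x y : R) :
  unit_lemniscate x y <->
  (x ^ 2 + y ^ 2) * (2 - (x ^ 2 + y ^ 2)) = 4 * y ^ 2.
Proof. unfold unit_lemniscate; split; intros H; nra. Qed.

(** With [(wx, wy)] the vector [w] and [(x, y)] the vector [s], the three length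
    conditions become the relations [orth], [norm] and [circ] of the proof. *)
Lemma unit_linkage_midpoint (xA yA xB yB : R) :
  unit_linkage xA yA xB yB ->
  unit_lemniscate ((xA + xB) / 2) ((yA + yB) / 2).
Proof.
intros [HA [HB [HAB side]]]; apply unit_lemniscate_iff.
set (x := (xA + xB) / 2); set (y := (yA + yB) / 2).
pose (wx := xA - xB + 2); pose (wy := yA - yB).
assert (orth : x * wx + y * wy = 0) by (unfold x, y, wx, wy; lra).
assert (norm : x ^ 2 + y ^ 2 + (wx ^ 2 + wy ^ 2) / 4 = 2)
  by (unfold x, y, wx, wy; lra).
assert (circ : wx ^ 2 + wy ^ 2 = 4 * wx) by (unfold wx, wy; lra).
replace (2 - (x ^ 2 + y ^ 2)) with wx by lra.
destruct (Req_dec wx 0) as [w0 | wn0].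
- (* The parallelogram: [w = 0], so both heights vanish. *)
  assert (wy0 : wy = 0) by (rewrite w0 in circ; nra).
  assert (y0 : y = 0) by (unfold wy in wy0; unfold y; nra).
  rewrite w0, y0; ring.
- (* Squaring [orth] gives the identity multiplied by [wx]. *)
  apply (Rmult_eq_reg_l wx); [| exact wn0].
  assert (sq : (x * wx) ^ 2 = (y * wy) ^ 2)
    by (replace (x * wx) with (- (y * wy)) by lra; ring).
  replace (wx * ((x ^ 2 + y ^ 2) * wx))
    with ((x * wx) ^ 2 + y ^ 2 * wx ^ 2) by ring.
  rewrite sq.
  replace ((y * wy) ^ 2 + y ^ 2 * wx ^ 2)
    with (y ^ 2 * (wx ^ 2 + wy ^ 2)) by ring.
  rewrite circ; ring.
Qed.

Lemma unit_linkage_exists (x y : R) :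
  unit_lemniscate x y ->
  exists xA yA xB yB : R,
    unit_linkage xA yA xB yB /\ x = (xA + xB) / 2 /\ y = (yA + yB) / 2.
Proof.
intros L%unit_lemniscate_iff; remember (x ^ 2 + y ^ 2) as r eqn:Er.
destruct (Req_dec r 0) as [r0 | rn0].
- assert (x0 : x = 0) by nra; assert (y0 : y = 0) by nra.
  exists 0, 1, 0, (-1); unfold unit_linkage; subst x y; repeat split; lra.
- (* [A = F1 + s + w / 2] and [B = F2 + s - w / 2] for
     [w = (2 - r, - 4 x k)], which is [- 4 k (- y, x)]. *)
  pose (k := y / r).
  assert (ky : y = k * r) by (unfold k; field; exact rn0).
  assert (rpos : 0 < r) by nra.
  assert (kr : 4 * k ^ 2 * r = 2 - r).
  { apply (Rmult_eq_reg_l r); [| exact rn0].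
    rewrite L, ky; ring. }
  assert (xx : x ^ 2 = r * (r + 2) / 4) by lra.
  assert (xk : 16 * (x ^ 2 * k ^ 2) = 4 - r ^ 2).
  { rewrite xx. replace (16 * (r * (r + 2) / 4 * k ^ 2))
      with ((r + 2) * (4 * k ^ 2 * r)) by field.
    rewrite kr; ring. }
  assert (yk : 4 * (y * k) = 2 - r) by (rewrite ky, <- kr; ring).
  assert (xyk : 4 * (x * y * k) = x * (2 - r)) by (rewrite <- yk; ring).
  exists (x - r / 2), (y - 2 * x * k), (x + r / 2), (y + 2 * x * k).
  unfold unit_linkage; repeat split; try lra.
  destruct (Req_dec y 0) as [y0 | yn0].
  + right. assert (k0 : k = 0) by (unfold k; rewrite y0; field; exact rn0).
    rewrite y0, k0; lra.
  + left.
    (* The product of the heights is [k^2 (r^2 - 4 x^2) = - 2 r k^2]. *)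
    replace ((y - 2 * x * k) * (y + 2 * x * k)) with (r / 2 - 1).
    * assert (0 < y ^ 2) by nra; nra.
    * replace ((y - 2 * x * k) * (y + 2 * x * k))
        with (y ^ 2 - 4 * (x ^ 2 * k ^ 2)) by ring.
      lra.
Qed.

(** * Coordinates adapted to the foci *)

Definition focal (F1 F2 : point) (x y : R) : point :=
  let p := (fst F2 - fst F1) / 2 in
  let q := (snd F2 - snd F1) / 2 in
  ((fst F1 + fst F2) / 2 + x * p - y * q,
   (snd F1 + snd F2) / 2 + x * q + y * p).

Definition half_focal_distance (F1 F2 : point) : R := pdist F1 F2 / 2.

Lemma focal_comb (F1 F2 : point) (t x y x' y' : R) :
  affine_comb t (focal F1 F2 x y) (focal F1 F2 x' y') =
  focal F1 F2 ((1 - t) * x + t * x') ((1 - t) * y + t * y').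
Proof. destruct F1, F2; unfold focal, affine_comb; simpl; f_equal; field. Qed.

Lemma focal_midpoint (F1 F2 : point) (x y x' y' : R) :
  midpoint (focal F1 F2 x y) (focal F1 F2 x' y') =
  focal F1 F2 ((x + x') / 2) ((y + y') / 2).
Proof. unfold midpoint; rewrite focal_comb; f_equal; field. Qed.

Lemma focal_axis (F1 F2 : point) (t : R) :
  affine_comb t F1 F2 = focal F1 F2 (2 * t - 1) 0.
Proof. destruct F1, F2; unfold focal, affine_comb; simpl; f_equal; field. Qed.

Lemma distinct_sqr_pos (F1 F2 : point) :
  F1 <> F2 -> 0 < (fst F2 - fst F1) ^ 2 + (snd F2 - snd F1) ^ 2.
Proof.
destruct F1 as [a b], F2 as [c d]; simpl fst; simpl snd; intros hF.
destruct (Req_dec a c) as [<- |]; [destruct (Req_dec b d) as [<- |] |].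
- contradiction hF; reflexivity.
- apply Rplus_le_lt_0_compat; [apply pow2_ge_0 | apply sqr_pos; lra].
- apply Rplus_lt_le_0_compat; [apply sqr_pos; lra | apply pow2_ge_0].
Qed.

Lemma focal_surj (F1 F2 P : point) :
  F1 <> F2 -> exists x y : R, P = focal F1 F2 x y.
Proof.
intros hF; pose proof (distinct_sqr_pos _ _ hF) as npos.
destruct F1 as [a b], F2 as [c d], P as [z w]; cbn [fst snd] in npos.
exists (((2 * z - a - c) * (c - a) + (2 * w - b - d) * (d - b))
        / ((c - a) ^ 2 + (d - b) ^ 2)),
       (((2 * w - b - d) * (c - a) - (2 * z - a - c) * (d - b))
        / ((c - a) ^ 2 + (d - b) ^ 2)).
unfold focal; cbn [fst snd]; f_equal; field; lra.
Qed.

Lemma half_focal_distance_pos (F1 F2 : point) :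
  F1 <> F2 -> 0 < half_focal_distance F1 F2.
Proof.
intros hF; pose proof (distinct_sqr_pos _ _ hF) as npos.
unfold half_focal_distance, pdist, dist_euc, Rsqr.
apply Rdiv_lt_0_compat; [apply sqrt_lt_R0 | ]; lra.
Qed.

Lemma focal_pdist (F1 F2 : point) (x y x' y' : R) :
  pdist (focal F1 F2 x y) (focal F1 F2 x' y') =
  half_focal_distance F1 F2 * sqrt ((x - x') ^ 2 + (y - y') ^ 2).
Proof.
unfold half_focal_distance, pdist, dist_euc.
destruct F1 as [a b], F2 as [c d]; unfold focal, Rsqr; cbn [fst snd].
replace (sqrt ((a - c) * (a - c) + (b - d) * (b - d)) / 2)
  with (sqrt (((a - c) ^ 2 + (b - d) ^ 2) / 2 ^ 2)).
- pose proof (sum_sqr_nonneg (a - c) (b - d)).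
  rewrite <- sqrt_mult by (apply sum_sqr_nonneg || lra).
  f_equal; field.
- rewrite sqrt_div, sqrt_pow2 by (apply sum_sqr_nonneg || lra).
  do 2 f_equal; ring.
Qed.

Lemma focal_pdist_left (F1 F2 : point) (x y : R) :
  pdist F1 (focal F1 F2 x y) =
  half_focal_distance F1 F2 * sqrt ((x + 1) ^ 2 + y ^ 2).
Proof.
replace (pdist F1 _) with (pdist (focal F1 F2 (-1) 0) (focal F1 F2 x y)).
- rewrite focal_pdist; do 2 f_equal; ring.
- f_equal; destruct F1, F2; unfold focal; simpl; f_equal; field.
Qed.

Lemma focal_pdist_right (F1 F2 : point) (x y : R) :
  pdist F2 (focal F1 F2 x y) =
  half_focal_distance F1 F2 * sqrt ((x - 1) ^ 2 + y ^ 2).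
Proof.
replace (pdist F2 _) with (pdist (focal F1 F2 1 0) (focal F1 F2 x y)).
- rewrite focal_pdist; do 2 f_equal; ring.
- f_equal; destruct F1, F2; unfold focal; simpl; f_equal; field.
Qed.

Lemma focal_inj_snd (F1 F2 : point) (x y x' y' : R) :
  F1 <> F2 -> focal F1 F2 x y = focal F1 F2 x' y' -> y = y'.
Proof.
intros hF E.
assert (D : pdist (focal F1 F2 x y) (focal F1 F2 x' y') = 0).
{ rewrite E; unfold pdist; apply distance_refl. }
rewrite focal_pdist in D.
pose proof (half_focal_distance_pos _ _ hF).
apply Rmult_integral in D as [D | D]; [lra |].
apply sqrt_eq_0 in D; [| apply sum_sqr_nonneg].
pose proof (pow2_ge_0 (x - x')).
destruct (Req_dec (y - y') 0) as [| ne]; [lra |].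
apply sqr_pos in ne; lra.
Qed.

(** * The linkage and the lemniscate in focal coordinates *)

Lemma focal_on_line (F1 F2 : point) (x y : R) :
  F1 <> F2 -> on_line F1 F2 (focal F1 F2 x y) <-> y = 0.
Proof.
intros hF; split.
- intros [t E]; rewrite focal_axis in E.
  exact (focal_inj_snd _ _ _ _ _ _ hF E).
- intros ->; exists ((x + 1) / 2); rewrite focal_axis; f_equal; field.
Qed.

Lemma focal_opposite_sides (F1 F2 : point) (xA yA xB yB : R) :
  F1 <> F2 ->
  opposite_sides F1 F2 (focal F1 F2 xA yA) (focal F1 F2 xB yB) <->
  yA * yB < 0.
Proof.
intros hF; unfold opposite_sides; rewrite !focal_on_line by exact hF; split.
- intros [nA [nB [Z [lineZ [t [Ht EZ]]]]]].
  rewrite EZ, focal_comb, focal_on_line in lineZ by exact hF.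
  (* With heights of the same sign, the convex combination in [lineZ] could not
     vanish: multiplying it by [yA] and by [yB] makes all its terms
     nonnegative. *)
  assert (0 < yA ^ 2) by (apply sqr_pos; exact nA).
  assert (0 < yB ^ 2) by (apply sqr_pos; exact nB).
  assert ((1 - t) * yA ^ 2 + t * (yA * yB) = 0)
    by (replace 0 with (yA * 0) by ring; rewrite <- lineZ; ring).
  assert ((1 - t) * (yA * yB) + t * yB ^ 2 = 0)
    by (replace 0 with (yB * 0) by ring; rewrite <- lineZ; ring).
  destruct (Rlt_le_dec (yA * yB) 0) as [| ge]; [assumption | exfalso].
  destruct (Rlt_le_dec t 1); nra.
- intros neg; split; [intros ->; lra | split; [intros ->; lra |]].
  assert (dn0 : yA - yB <> 0) by nra.
  pose (t := yA / (yA - yB)).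
  exists (affine_comb t (focal F1 F2 xA yA) (focal F1 F2 xB yB)); split.
  + rewrite focal_comb, focal_on_line by exact hF.
    unfold t; field; exact dn0.
  + exists t; split; [| reflexivity].
    assert (Et : t * (yA - yB) = yA) by (unfold t; field; exact dn0).
    assert (0 < (yA - yB) ^ 2) by (apply sqr_pos; exact dn0).
    assert (t * (yA - yB) ^ 2 = yA ^ 2 - yA * yB)
      by (replace (t * (yA - yB) ^ 2) with (t * (yA - yB) * (yA - yB)) by ring;
          rewrite Et; ring).
    split; nra.
Qed.

Lemma scaled_sqrt_eq_iff (h s t : R) :
  0 < h -> 0 <= s -> 0 <= t -> h * sqrt s = h * sqrt t <-> s = t.
Proof.
intros hpos s0 t0; split; [| intros ->; reflexivity].
intros E; apply sqrt_inj; trivial; apply (Rmult_eq_reg_l h); lra.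
Qed.

Lemma focal_linkage_position (F1 F2 : point) (xA yA xB yB : R) :
  F1 <> F2 ->
  linkage_position F1 F2 (focal F1 F2 xA yA) (focal F1 F2 xB yB) <->
  unit_linkage xA yA xB yB.
Proof.
intros hF; unfold linkage_position, linkage_lengths.
rewrite focal_opposite_sides, !focal_on_line by exact hF.
pose proof (half_focal_distance_pos _ _ hF) as hpos.
set (h := half_focal_distance F1 F2) in *.
(* Both prescribed lengths are put in the form [h * sqrt _]. *)
assert (long : pdist F1 F2 = h * sqrt 4).
{ replace 4 with (2 ^ 2) by ring; rewrite sqrt_pow2 by lra.
  unfold h, half_focal_distance; field. }
assert (short : 1 / sqrt 2 * pdist F1 F2 = h * sqrt 2).
{ pose proof Rlt_sqrt2_0.
  replace (pdist F1 F2) with (h * (sqrt 2 * sqrt 2)).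
  - field; lra.
  - rewrite sqrt_sqrt by lra; unfold h, half_focal_distance; field. }
rewrite short, long.
rewrite focal_pdist_left, focal_pdist_right, focal_pdist; fold h.
rewrite !scaled_sqrt_eq_iff by (apply sum_sqr_nonneg || lra).
unfold unit_linkage; tauto.
Qed.

Lemma focal_lemniscate (F1 F2 : point) (x y : R) :
  F1 <> F2 -> lemniscate F1 F2 (focal F1 F2 x y) <-> unit_lemniscate x y.
Proof.
intros hF; unfold lemniscate, unit_lemniscate.
pose proof (half_focal_distance_pos _ _ hF) as hpos.
set (h := half_focal_distance F1 F2) in *.
replace (1 / 4 * pdist F1 F2 ^ 2) with (h * h * sqrt 1)
  by (rewrite sqrt_1; unfold h, half_focal_distance; field).
rewrite focal_pdist_left, focal_pdist_right; fold h.
replace (h * sqrt ((x + 1) ^ 2 + y ^ 2) * (h * sqrt ((x - 1) ^ 2 + y ^ 2)))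
  with (h * h * sqrt (((x + 1) ^ 2 + y ^ 2) * ((x - 1) ^ 2 + y ^ 2)))
  by (rewrite sqrt_mult by apply sum_sqr_nonneg; ring).
apply scaled_sqrt_eq_iff; [nra | apply Rmult_le_pos; apply sum_sqr_nonneg | lra].
Qed.

Theorem mainTheorem1 (F1 F2 : point) (hF : F1 <> F2) :
  forall X : point,
    (exists A B : point, linkage_position F1 F2 A B /\ X = midpoint A B)
    <-> lemniscate F1 F2 X.
Proof.
intros X; split.
- intros [A [B [HAB ->]]].
  destruct (focal_surj F1 F2 A hF) as [xA [yA ->]].
  destruct (focal_surj F1 F2 B hF) as [xB [yB ->]].
  rewrite focal_midpoint, focal_lemniscate by exact hF.
  apply unit_linkage_midpoint, (focal_linkage_position F1 F2); assumption.
- destruct (focal_surj F1 F2 X hF) as [x [y ->]].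
  rewrite focal_lemniscate by exact hF.
  intros [xA [yA [xB [yB [HAB [-> ->]]]]]]%unit_linkage_exists.
  exists (focal F1 F2 xA yA), (focal F1 F2 xB yB); split.
  + apply focal_linkage_position; assumption.
  + symmetry; apply focal_midpoint.
Qed.
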